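(* Fix an integer $i\ge0$. Then, as $q\to\infty$, the dominant term of $f_i(\mathbb{S}^3_q)$ is $\binom{\binom{q}{3}}{i+1}$ (that is, $f_i(\mathbb{S}^3_q)\big/\binom{\binom{q}{3}}{i+1}\to1$). In particular, $f_i(\mathbb{T}^3_q)$, $f_i(\mathbb{L}^3_q)$ and $f_i(\mathbb{S}^3_q)$ are all $O(q^{3i+3})$.
   Context: $f_i(\Delta)$ denotes the number of $i$-dimensional faces of a simplicial complex $\Delta$. Let $\mathsf{k}$ be a field, $[q]=\{1,\dots,q\}$, and $\mathcal{N}^r_q=\{\mathbf a\in\mathbb{N}^q : a_1+\cdots+a_q=r\}$. The $q$-extremal ideal $\mathcal{E}_q$ is the ideal of $\mathsf{k}[x_A : \emptyset\ne A\subseteq[q]]$ generated by $\epsilon_i=\prod_{A\ni i}x_A$, $i\in[q]$. Its power $\mathcal{E}_q^{\,r}$ is minimally generated by the monomials $\epsilon^{\mathbf a}=\epsilon_1^{a_1}\cdots\epsilon_q^{a_q}$, $\mathbf a\in\mathcal{N}^r_q$. The Taylor complex $\mathbb{T}^r_q$ is the full simplex on $\mathcal{N}^r_q$, each face $\sigma$ being labeled by $\mathbf{m}_\sigma=\mathrm{lcm}(\epsilon^{\mathbf a}:\mathbf a\in\sigma)$. The Scarf complex $\mathbb{S}^r_q$ is the subcomplex of all $\sigma$ with $\mathbf{m}_\sigma\ne\mathbf{m}_\tau$ for every $\tau\subseteq\mathcal{N}^r_q$, $\tau\neq\sigma$. $\mathbb{L}^3_q$ is a simplicial complex from earlier work with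 $\mathbb{S}^3_q\subseteq\mathbb{L}^3_q\subseteq\mathbb{T}^3_q$; it enters only through its face numbers $f_i(\mathbb{L}^3_q)=q\binom{q-1}{i}+\binom{\binom{q}{3}+2\binom{q}{2}}{i+1}$. For comparison, $f_i(\mathbb{T}^3_q)=\binom{\binom{q+2}{3}}{i+1}$. *)

(* Defs.v *)
From mathcomp Require Import all_boot all_order all_algebra.
From mathcomp Require Import mpoly.

Set Implicit Arguments.
Unset Strict Implicit.
Unset Printing Implicit Defensive.

Import GRing.Theory.
Local Open Scope ring_scope.

(* The set [q] is modelled by 'I_q = {0, ..., q-1}. *)

Definition nonempty_subset (q : nat) := {A : {set 'I_q} | A != set0}.

(* k[x_A : A a nonempty subset of [q]]; [mpoly] numbers its variables by
   ordinals, and [enum_rank] is the corresponding bijection. *)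
Definition extremal_ring (k : fieldType) (q : nat) :=
  {mpoly k[#|{: nonempty_subset q}|]}.

Definition xvar (k : fieldType) (q : nat) (A : nonempty_subset q) :
  extremal_ring k q := 'X_(enum_rank A).

Definition extremal_gen (k : fieldType) (q : nat) (i : 'I_q) :
    extremal_ring k q :=
  \prod_(A : nonempty_subset q | i \in val A) xvar k A.

(* The vectors a in N^q with a_1 + ... + a_q = r. All entries are at most r, so
   storing them in 'I_r.+1 loses nothing and yields a finType. *)
Definition exponents (r q : nat) :=
  {a : {ffun 'I_q -> 'I_r.+1} | (\sum_(i < q) a i == r)%N}.

Definition extremal_power_gen (k : fieldType) (r q : nat) (a : exponents r q) :
    extremal_ring k q :=
  \prod_(i < q) extremal_gen k i ^+ (val a i).

(* Each generator is a monomial with coefficient 1, so [mlead] is its exponent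
   vector; [mlcm] is the lcm of monomials given by exponent vectors, and the
   empty lcm is the monomial 1. *)
Definition face_label (k : fieldType) (r q : nat) (s : {set exponents r q}) :
    extremal_ring k q :=
  'X_[\big[@mlcm _ / 0%MM]_(a in s) mlead (extremal_power_gen k a)].

(* Complexes are sets of faces, the empty face included. *)
Definition simplicial_complex (V : finType) (D : {set {set V}}) : Prop :=
  forall s t : {set V}, t \in D -> s \subset t -> s \in D.

Definition face_number (V : finType) (i : nat) (D : {set {set V}}) : nat :=
  #|[set s in D | #|s| == i.+1]|.

Definition taylor_complex (r q : nat) : {set {set exponents r q}} :=
  powerset [set: exponents r q].

Definition scarf_complex (k : fieldType) (r q : nat) :
    {set {set exponents r q}} :=
  [set s in taylor_complex r q |
    [forall t : {set exponents r q},
      (t != s) ==> (face_label k s != face_label k t)]].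

(* What is assumed of a complex L^3_q lying between the Scarf and the Taylor
   complex. Such a complex exists for every q: its facets are
   {a | a_i >= 2} for i in [q] and {a | a_i <= 2 for all i}. *)
Definition is_L3 (k : fieldType) (q : nat) (L : {set {set exponents 3 q}}) :
    Prop :=
  [/\ simplicial_complex L,
      scarf_complex k 3 q \subset L,
      L \subset taylor_complex 3 q
    & forall j : nat, face_number j L =
        (q * 'C(q.-1, j) + 'C('C(q, 3) + 2 * 'C(q, 2), j.+1))%N].

(* Main.v *)
Require Import Defs.
From mathcomp Require Import all_boot all_order all_algebra.
From mathcomp Require mpoly.

(** Both sides of the limit come from two simplices.  A set of squarefree
    exponent vectors (the indicators of [r]-subsets of [[q]]) is always a face
    of the Scarf complex, so that complex contains the full simplex on
    ['C(q, r)] vertices; on the other side it is contained in the Taylor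
    complex, the full simplex on at most ['C(q + r - 1, r)] vertices.  For
    [r = 3] this gives
      ['C('C(q, 3), i + 1) <= f_i(S) <= 'C('C(q + 2, 3), i + 1)],
    and the two bounds are asymptotically equivalent.

    Why squarefree sets are Scarf faces ([squarefree_mem_scarf]): the exponent
    of [x_A] in a label is the maximum over the face of the weight
    [a(A) = \sum_(i in A) a_i] ([label_exponent_eq]).  Suppose that [t] has
    the same label as the squarefree face [s].  The singletons [A] show that
    [t] is squarefree as well.  If [A] has [r] elements, the exponent of [x_A]
    is [r] exactly when some vector of the face is concentrated on [A], and the
    only squarefree such vector is the indicator of [A]; so the label determines
    which indicators belong to the face, and [t = s].

    Asymptotics: if [v -> oo] and [u / v -> 1] then
    ['C(u, m) / 'C(v, m) -> 1] ([cvg_bin_ratio]).  This is used twice, for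
    [(q + 2) / q] with [m = 3] and then for ['C(q + 2, 3) / 'C(q, 3)] with
    [m = i + 1].  The [O(q^(3 i + 3))] bounds hold for every complex on the same
    vertices, because each is contained in the Taylor complex. *)

Set Implicit Arguments.
Unset Strict Implicit.
Unset Printing Implicit Defensive.

(** * Exponents of face labels *)

Definition part_weight r q (a : exponents r q) (A : {set 'I_q}) : nat :=
  \sum_(i in A) val a i.

Definition label_exponent r q (s : {set exponents r q}) (A : {set 'I_q}) : nat :=
  \max_(a in s) part_weight a A.

(* The polynomial notations are confined to a module: they are incompatible
   with the topological notations used below. *)
Module LabelExponents.
Import mpoly.

(** The variable [x_A] divides [epsilon_i] exactly once when [i] lies in [A], so
    each factor [epsilon_i ^ a_i] with [i] in [A] contributes [a_i]. *)
Lemma mlead_extremal_power_gen (k : fieldType) r q (a : exponents r q)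
    (A : nonempty_subset q) :
  mlead (extremal_power_gen k a) (enum_rank A) = part_weight a (val A).
Proof.
rewrite /extremal_power_gen /extremal_gen /xvar.
under eq_bigr => i _ do rewrite mprodXE mpolyXn.
rewrite mprodXE mleadXm mnm_sumE /part_weight [RHS]big_mkcond /=.
apply: eq_bigr => i _; rewrite mulmnE mnm_sumE.
have [iA|iA] := boolP (i \in val A).
  rewrite (bigD1 A) //= mnm1E eqxx big1 ?addn0 ?mul1n // => B /andP[_ BA].
  by rewrite mnm1E (inj_eq enum_rank_inj) (negbTE BA).
rewrite big1 // => B iB; rewrite mnm1E (inj_eq enum_rank_inj).
by case: eqP iA => // <-; rewrite iB.
Qed.

(** This replaces the equality of two polynomials by that of numbers which do
    not depend on the field [k]. *)
Lemma label_exponent_eq (k : fieldType) r q (s t : {set exponents r q})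
    (A : {set 'I_q}) :
  face_label k s = face_label k t -> A != set0 ->
  label_exponent s A = label_exponent t A.
Proof.
move=> /(congr1 (@mlead _ _)); rewrite !mleadXm => /mnmP eq_st A0.
pose B : nonempty_subset q := Sub A A0.
have labelE (u : {set exponents r q}) :
    (\big[@mlcm _ / 0%MM]_(a in u) mlead (extremal_power_gen k a)) (enum_rank B)
    = label_exponent u A.
  rewrite (big_morph (fun m : 'X_{1.._} => m (enum_rank B))
             (id1 := 0) (op1 := maxn)).
  - by apply: eq_bigr => a _; rewrite mlead_extremal_power_gen.
  - by move=> m1 m2; rewrite mnmE.
  - by rewrite mnm0E.
by rewrite -!labelE eq_st.
Qed.

End LabelExponents.

Import LabelExponents.

(** * Squarefree faces of the Scarf complex *)

Section SquarefreeFaces.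
Variables (r q : nat).

Lemma sum_exponents (a : exponents r q) : \sum_(i < q) val a i = r.
Proof. exact/eqP/(valP a). Qed.

Definition squarefree (a : exponents r q) : bool := [forall i, val a i <= 1].

Definition esupport (a : exponents r q) : {set 'I_q} := [set i | val a i != ord0].

Lemma part_weight_le (a : exponents r q) (A : {set 'I_q}) : part_weight a A <= r.
Proof.
rewrite -[leqRHS](sum_exponents a) [leqRHS](bigID [in A]) /=.
exact: leq_addr.
Qed.

Lemma part_weight_esupport (a : exponents r q) : part_weight a (esupport a) = r.
Proof.
rewrite -[RHS](sum_exponents a) [RHS](bigID [in esupport a]) /= [X in _ + X]big1 ?addn0 //.
by move=> i; rewrite inE negbK => /eqP ->.
Qed.

(** Once [b] is concentrated on the support of [a], squarefreeness gives
    [b_i <= a_i] everywhere; the two sums being equal, so are the vectors. *)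
Lemma squarefree_eq (a b : exponents r q) :
  squarefree b -> part_weight b (esupport a) = r -> b = a.
Proof.
move=> /forallP b1 wb.
have leba i : val b i <= val a i.
  have [ia|] := boolP (i \in esupport a).
    by apply: leq_trans (b1 i) _; rewrite lt0n; move: ia; rewrite inE.
  move=> ia; move: (sum_exponents b); rewrite (bigID [in esupport a]) /=.
  rewrite -/(part_weight _ _) wb -[RHS]addn0 => /addnI/eqP.
  by rewrite sum_nat_eq0 => /forallP/(_ i)/implyP/(_ ia)/eqP ->.
have [_] := leqif_sum (fun i (_ : true) => leqif_eq (leba i)).
rewrite !sum_exponents eqxx => /esym/forallP eqba.
by apply/val_inj/ffunP => i; apply/val_inj/eqP/(implyP (eqba i)).
Qed.

Lemma esupport_neq0 (a : exponents r q) : 0 < r -> esupport a != set0.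
Proof.
apply: contraTneq => a0; move: (part_weight_esupport a).
by rewrite a0 /part_weight big_set0 => <-.
Qed.

(** If [a] is in [s], the label of [s] has exponent [r] at the support of [a];
    a vector of [t] reaching that value must be [a] itself. *)
Lemma squarefree_label_sub (s t : {set exponents r q}) :
  0 < r ->
  (forall A, A != set0 -> label_exponent s A = label_exponent t A) ->
  (forall a, a \in t -> squarefree a) -> s \subset t.
Proof.
move=> r0 eq_st t1; apply/subsetP => a sa.
have /exists_inP[b tb /eqP wb] :
    [exists b in t, part_weight b (esupport a) == r].
  apply: contraT; rewrite negb_exists_in => /forall_inP nt.
  have t_lt : label_exponent t (esupport a) <= r.-1.
    apply/bigmax_leqP => b tb.
    by rewrite -ltnS (prednK r0) ltn_neqAle nt // part_weight_le.
  have s_ge : part_weight a (esupport a) <= label_exponent s (esupport a).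
    by rewrite /label_exponent (bigmax_sup a).
  rewrite part_weight_esupport eq_st ?esupport_neq0 // in s_ge.
  by move: (leq_trans s_ge t_lt); rewrite leqNgt prednK // leqnn.
by rewrite -(squarefree_eq (t1 b tb) wb).
Qed.

(** The exponents at the singletons force any [t] with the same label to be
    squarefree, and then [squarefree_label_sub] applies in both directions.  For
    [r = 0] the claim fails: the zero vector and the empty face both have
    label 1. *)
Lemma squarefree_mem_scarf (k : fieldType) (s : {set exponents r q}) :
  0 < r -> (forall a, a \in s -> squarefree a) -> s \in scarf_complex k r q.
Proof.
move=> r0 s1; rewrite inE powersetE subsetT /=.
apply/forallP => t; apply/implyP; apply: contraNneq => eq_lab.
have eq_st A : A != set0 -> label_exponent s A = label_exponent t A.
  exact: label_exponent_eq eq_lab.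
have t1 a : a \in t -> squarefree a.
  move=> ta; apply/forallP => i.
  have i0 : [set i] != set0 by apply/set0Pn; exists i; rewrite inE.
  have <- : part_weight a [set i] = val a i by rewrite /part_weight big_set1.
  apply: leq_trans (_ : label_exponent t [set i] <= 1).
    by rewrite (bigmax_sup a).
  rewrite -eq_st //; apply/bigmax_leqP => b /s1/forallP/(_ i).
  by rewrite /part_weight big_set1.
rewrite eqEsubset !squarefree_label_sub // => A A0.
by rewrite eq_st.
Qed.

(** The support map sends the squarefree vectors onto the [r]-subsets: a
    preimage of [B] is its indicator. *)
Lemma card_squarefree : 0 < r -> 'C(q, r) <= #|[set a | squarefree a]|.
Proof.
move=> r0; rewrite -[in leqLHS](card_ord q) -card_draws.
apply: leq_trans (leq_imset_card esupport _).
apply/subset_leq_card/subsetP => B; rewrite inE => /eqP cardB.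
pose f : {ffun 'I_q -> 'I_r.+1} := [ffun i => inord (i \in B)].
have fE i : f i = (i \in B) :> nat by rewrite ffunE inordK //; case: (i \in B).
have fr : (\sum_(i < q) f i == r)%N.
  under eq_bigr => i _ do rewrite fE.
  by rewrite -cardB -sum1_card [eqbRHS]big_mkcond.
apply/imsetP; exists (Sub f fr); rewrite ?inE.
  by apply/forallP => i; rewrite SubK fE leq_b1.
by apply/setP => i; rewrite inE SubK -val_eqE /= fE; case: (i \in B).
Qed.

End SquarefreeFaces.

(** * Bounds on the face numbers *)

(** With [q = p + 1] parts, [card_ord_partitions] counts the vectors of sum
    [r + 1] as ['C(p + (r + 1), p)]; for [q = 0] both sides vanish, because the
    empty sum is not [r + 1]. *)
Lemma card_exponents_le (r q : nat) :
  #|{: exponents r.+1 q}| <= 'C(q + r, r.+1).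
Proof.
case: q => [|q].
  rewrite bin_small // leqn0; apply/eqP/eq_card0 => a.
  by move: (sum_exponents a); rewrite big_ord0.
have <- : 'C(q + r.+1, q) = 'C(q.+1 + r, r.+1).
  by rewrite -bin_sub ?leq_addr // addKn addSnnS.
rewrite -card_ord_partitions -cardsT.
pose f (a : exponents r.+1 q.+1) : q.+1.-tuple 'I_r.+2 :=
  [tuple val a i | i < q.+1].
have f_inj : injective f.
  move=> a b eq_ab; apply/val_inj/ffunP => i.
  by move: (congr1 (fun t => tnth t i) eq_ab); rewrite !tnth_mktuple.
rewrite -(card_imset _ f_inj); apply/subset_leq_card/subsetP => _ /imsetP[a _ ->].
rewrite inE big_tuple -[eqbRHS](sum_exponents a).
by under eq_bigr => i _ do rewrite tnth_mktuple.
Qed.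

Lemma face_number_sub (V : finType) (i : nat) (D E : {set {set V}}) :
  D \subset E -> face_number i D <= face_number i E.
Proof.
move=> /subsetP DE; apply/subset_leq_card/subsetP => s.
by rewrite !inE => /andP[/DE -> ->].
Qed.

Lemma face_number_simplex (V : finType) (i : nat) (A : {set V}) :
  face_number i (powerset A) = 'C(#|A|, i.+1).
Proof. by rewrite -cards_draws; apply: eq_card => s; rewrite !inE. Qed.

Lemma face_number_scarf_ge k r q i :
  0 < r -> 'C('C(q, r), i.+1) <= face_number i (scarf_complex k r q).
Proof.
move=> r0; apply: leq_trans (leq_bin2l _ (card_squarefree q r0)) _.
rewrite -face_number_simplex; apply/face_number_sub/subsetP => s.
rewrite powersetE => /subsetP s1; apply: squarefree_mem_scarf => // a /s1.
by rewrite inE.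
Qed.

Lemma face_number_le_taylor i q r (D : {set {set exponents r.+1 q}}) :
  face_number i D <= 'C('C(q + r, r.+1), i.+1).
Proof.
apply: leq_trans (leq_bin2l _ (card_exponents_le r q)).
rewrite -cardsT -face_number_simplex.
by apply/face_number_sub/subsetP => s _; rewrite powersetE subsetT.
Qed.

(** This crude bound makes ['C(n, m + 1)] tend to infinity with [n]. *)
Lemma leq_subn_bin n m : n - m <= 'C(n, m.+1).
Proof.
elim: n => // n IHn; rewrite binS; have [mn|nm] := leqP m n.
  by rewrite subSn // -addn1 leq_add ?bin_gt0.
by move: nm; rewrite -subn_eq0 => /eqP ->.
Qed.

Lemma leq_bin_exp n m : 'C(n, m) <= n ^ m.
Proof.
elim: m => [|m IHm]; first by rewrite bin0.
rewrite expnS -(leq_pmul2l (ltn0Sn m)) mul_bin_left.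
apply: leq_trans (leq_mul (leq_subr m n) IHm) _.
exact: leq_pmull.
Qed.

(** Every ['C(q + r, r + 1)] is at most [((r + 1) q)^(r + 1)], as
    [q + r <= (r + 1) q] for positive [q]. *)
Lemma face_number_le_exp i q r (D : {set {set exponents r.+1 q}}) :
  0 < q ->
  face_number i D <= r.+1 ^ (r.+1 * i.+1) * q ^ (r.+1 * i.+1).
Proof.
move=> q0; apply: leq_trans (face_number_le_taylor i D) _.
apply: leq_trans (leq_bin_exp _ _) _.
rewrite -expnMn expnM leq_exp2r //.
apply: leq_trans (leq_bin_exp _ _) _.
by rewrite leq_exp2r // mulSn leq_add2l leq_pmulr.
Qed.

From mathcomp Require Import all_classical all_reals all_analysis.
Import numFieldNormedType.Exports.
Import Order.TTheory GRing.Theory Num.Theory.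
Local Open Scope classical_set_scope.
Local Open Scope ring_scope.

(** * Asymptotics of binomial coefficients and face numbers *)

(** When [n < m] the truncated difference [n - m] of naturals is not the one in
    [R], but both get multiplied by ['C(n, m) = 0]. *)
Lemma natr_binS (R : numFieldType) n m :
  'C(n, m.+1)%:R = 'C(n, m)%:R * (n%:R - m%:R) / m.+1%:R :> R.
Proof.
apply: (mulIf (x := m.+1%:R)); first by rewrite pnatr_eq0.
rewrite divfK ?pnatr_eq0 // -natrM mulnC mul_bin_left.
have [mn|nm] := leqP m n; first by rewrite natrM natrB // mulrC.
by rewrite bin_small // muln0 mul0r.
Qed.

Section Asymptotics.
Variable R : realType.

Lemma cvg_natrV (v : nat -> nat) :
  v n @[n --> \oo] --> \oo -> (v n)%:R^-1 @[n --> \oo] --> (0 : R).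
Proof.
move=> voo; apply/gtr0_cvgV0; last exact/cvgrnyP.
near=> n; rewrite ltr0n; near: n; move/cvgnyPgt : voo; apply.
Unshelve. all: by end_near. Qed.

(** Induction on [m]: going from [m] to [m + 1] multiplies the ratio by
    [(u - m) / (v - m)], which tends to 1 because [m / v] tends to 0. *)
Lemma cvg_bin_ratio (u v : nat -> nat) (m : nat) :
  v n @[n --> \oo] --> \oo ->
  (u n)%:R / (v n)%:R @[n --> \oo] --> (1 : R) ->
  'C(u n, m)%:R / 'C(v n, m)%:R @[n --> \oo] --> (1 : R).
Proof.
move=> voo uv; elim: m => [|m IHm].
  by under eq_fun do rewrite !bin0 divr1; exact: cvg_cst.
have factor1 : ((u n)%:R - m%:R) / ((v n)%:R - m%:R) @[n --> \oo] --> (1 : R).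
  have mv : m%:R / (v n)%:R @[n --> \oo] --> (0 : R).
    rewrite -[X in _ --> X](mulr0 (m%:R : R)).
    by apply: cvgM; [exact: cvg_cst | exact: cvg_natrV].
  (* Divide numerator and denominator by [v]. *)
  have : ((u n)%:R / (v n)%:R - m%:R / (v n)%:R) / (1 - m%:R / (v n)%:R)
      @[n --> \oo] --> ((1 - 0) / (1 - 0) : R).
    apply: cvgM; first exact: cvgB.
    apply: cvgV; first by rewrite subr0 oner_neq0.
    by apply: cvgB => //; exact: cvg_cst.
  rewrite subr0 divr1; apply: cvg_trans; apply: near_eq_cvg.
  near=> n.
  have v0 : (v n)%:R != 0 :> R.
    by rewrite pnatr_eq0 -lt0n; near: n; move/cvgnyPgt : voo; apply.
  have -> : 1 - m%:R / (v n)%:R = ((v n)%:R - m%:R) / (v n)%:R :> R.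
    by rewrite mulrBl divff.
  by rewrite -mulrBl invfM invrK mulrACA mulVf // mulr1.
have : 'C(u n, m)%:R / 'C(v n, m)%:R
    * (((u n)%:R - m%:R) / ((v n)%:R - m%:R)) @[n --> \oo] --> (1 * 1 : R).
  exact: cvgM.
rewrite mulr1; apply: cvg_trans; apply: near_eq_cvg.
near=> n.
have m0 : m.+1%:R != 0 :> R by rewrite pnatr_eq0.
rewrite !natr_binS /= -[in RHS]mulf_div divff ?invr_neq0 // mulr1.
by rewrite mulf_div.
Unshelve. all: by end_near. Qed.

Lemma cvg_bin_shift (d m : nat) :
  'C(n + d, m)%:R / 'C(n, m)%:R @[n --> \oo] --> (1 : R).
Proof.
apply: cvg_bin_ratio; first exact: cvg_id.
have : 1 + d%:R / n%:R @[n --> \oo] --> (1 + d%:R * 0 : R).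
  apply: cvgD; first exact: cvg_cst.
  apply: cvgM; first exact: cvg_cst.
  by apply: cvg_natrV; exact: cvg_id.
rewrite mulr0 addr0; apply: cvg_trans; apply: near_eq_cvg.
near=> n.
have n0 : n%:R != 0 :> R by rewrite pnatr_eq0 -lt0n; near: n; exact: nbhs_infty_gt.
by rewrite natrD mulrDl divff.
Unshelve. all: by end_near. Qed.

Lemma cvgny_bin m : 'C(n, m.+1) @[n --> \oo] --> \oo.
Proof.
apply/cvgnyPge => A; near=> n.
apply: leq_trans (leq_subn_bin n m); rewrite leq_subRL; last first.
  by near: n; exact: nbhs_infty_ge.
by near: n; exact: nbhs_infty_ge.
Unshelve. all: by end_near. Qed.

Lemma natr_bigO (f : nat -> nat) (d N0 C : nat) :
  (forall n, (N0 <= n)%N -> (f n <= C * n ^ d)%N) ->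
  (fun n => (f n)%:R : R) =O_\oo (fun n => (n%:R : R) ^+ d).
Proof.
move=> fC; apply/eqO_exP; exists C.+1%:R; rewrite ?ltr0n //.
near=> n; rewrite !ger0_norm ?exprn_ge0 ?ler0n // -natrX -natrM ler_nat.
apply: leq_trans (fC n _) _; first by near: n; exact: nbhs_infty_ge.
by rewrite leq_mul2r leqnSn orbT.
Unshelve. all: by end_near. Qed.

(** Containment in the Taylor complex suffices for this bound, so [D] can be
    any family: the Scarf complexes, the Taylor complexes or those in between. *)
Lemma face_number_bigO r i (D : forall q : nat, {set {set exponents r.+1 q}}) :
  (fun q => (face_number i (D q))%:R : R)
    =O_\oo (fun q => (q%:R : R) ^+ (r.+1 * i.+1)).
Proof.
apply: (@natr_bigO _ _ 1%N (r.+1 ^ (r.+1 * i.+1))%N) => q.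
exact: face_number_le_exp.
Qed.

End Asymptotics.

(** * The face numbers of the cube of the extremal ideal *)

Theorem theorem8p3 (k : fieldType) (R : realType) (i : nat) :
  ((fun q : nat => (face_number i (scarf_complex k 3 q))%:R
                     / ('C('C(q, 3), i.+1))%:R : R) @ \oo --> (1 : R))
  /\ [/\ (fun q : nat => (face_number i (taylor_complex 3 q))%:R : R)
           =O_\oo (fun q : nat => (q%:R : R) ^+ (3 * i + 3)),
         (forall L : forall q : nat, {set {set exponents 3 q}},
           (forall q : nat, is_L3 k (L q)) ->
           (fun q : nat => (face_number i (L q))%:R : R)
             =O_\oo (fun q : nat => (q%:R : R) ^+ (3 * i + 3)))
       & (fun q : nat => (face_number i (scarf_complex k 3 q))%:R : R)
           =O_\oo (fun q : nat => (q%:R : R) ^+ (3 * i + 3))].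
Proof.
have taylorO (D : forall q : nat, {set {set exponents 3 q}}) :
    (fun q : nat => (face_number i (D q))%:R : R)
      =O_\oo (fun q : nat => (q%:R : R) ^+ (3 * i + 3)).
  by rewrite addnC -mulnS; exact: face_number_bigO.
split; last by split=> [|L _|]; exact: taylorO.
have lower : (fun=> 1 : R) @ \oo --> (1 : R) by exact: cvg_cst.
have upper : 'C('C(q + 2, 3), i.+1)%:R / 'C('C(q, 3), i.+1)%:R
    @[q --> \oo] --> (1 : R).
  by apply: cvg_bin_ratio; [exact: cvgny_bin | exact: cvg_bin_shift].
apply: squeeze_cvgr lower upper; near=> q.
have C0 : 0 < 'C('C(q, 3), i.+1)%:R :> R.
  by rewrite ltr0n bin_gt0; near: q; move/cvgnyPge : (cvgny_bin 2); apply.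
rewrite ler_pdivlMr // mul1r ler_nat face_number_scarf_ge //=.
by rewrite ler_pM2r ?invr_gt0 // ler_nat face_number_le_taylor.
Unshelve. all: by end_near. Qed.
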